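(* Let $n=p=1$ and $1\le q<\infty$. Then $\operatorname{cap}(K;W_1^1)=2$ for any non-empty compact set $K\subset\mathbb{R}$, and $\operatorname{cap}(G;W_1^1)=2$ for any non-empty open set $G\subset\mathbb{R}$. Moreover, for any non-empty bounded open set $G\subset\mathbb{R}$, $$\lim_{\alpha\to1-}(1-\alpha)^{1/q}\operatorname{cap}(G;B_{1,q}^\alpha)=q^{-1/q}\operatorname{cap}(G;W_1^1)=2q^{-1/q}.$$
   Context: For $f\in L^1(\mathbb{R})$ the modulus of continuity is $$\omega(f;\delta)_1=\sup_{0\le h\le\delta}\int_{\mathbb{R}}|f(x+h)-f(x)|\,dx,$$ and for $0<\alpha<1$, $1\le q<\infty$, $$\|f\|_{b^\alpha_{1,q}}=\left(\int_0^\infty\left(t^{-\alpha}\omega(f;t)_1\right)^q\frac{dt}{t}\right)^{1/q}.$$ For a compact set $K\subset\mathbb{R}$, let $\mathfrak{N}(K)$ be the set of all $f\in C_0^\infty(\mathbb{R})$ (smooth, compactly supported) such that $f(x)\ge1$ for all $x\in K$. Define $$\operatorname{cap}(K;W_1^1)=\inf\{\|f'\|_{L^1(\mathbb{R})}: f\in\mathfrak{N}(K)\},\qquad \operatorname{cap}(K;B_{1,q}^\alpha)=\inf\{\|f\|_{b^\alpha_{1,q}}: f\in\mathfrak{N}(K)\}.$$ For an open set $G\subset\mathbb{R}$ and $X=W_1^1$ or $X=B_{1,q}^\alpha$, $\operatorname{cap}(G;X)=\sup\{\operatorname{cap}(K;X):K\subset G,\ K\text{ compact}\}$. *)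

(* Defs.v *)
From HB Require Import structures.
From mathcomp Require Import all_boot all_order all_algebra.
From mathcomp Require Import all_classical all_reals all_analysis.

Set Implicit Arguments.
Unset Strict Implicit.
Unset Printing Implicit Defensive.

Import Order.TTheory GRing.Theory Num.Theory.
Import numFieldNormedType.Exports.

Local Open Scope ring_scope.
Local Open Scope ereal_scope.
Local Open Scope classical_set_scope.

(* C_0^oo(R), real-valued. The library's derivative is total, so smoothness
   demands genuine derivability of every iterated derivative. *)
Definition smooth_compact_support {R : realType} (f : R -> R) : Prop :=
  (forall (n : nat) (x : R), derivable (f^`(n)) x 1%R) /\
  compact (closure [set x | f x != 0%R]).

Definition modulus_continuity1 {R : realType} (f : R -> R) (delta : R)
    : \bar R :=
  ereal_sup [set \int[@lebesgue_measure R]_x `|f (x + h)%R - f x|%:E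
            | h in [set h : R | (0 <= h <= delta)%R]].

Definition besov_seminorm1 {R : realType} (alpha q : R) (f : R -> R) : \bar R :=
  (\int[@lebesgue_measure R]_(t in `]0%R, +oo[)
     (((t `^ (- alpha))%:E * modulus_continuity1 f t) `^ q * (t^-1)%:E))
  `^ (q^-1).

Definition cap_admissible {R : realType} (K : set R) : set (R -> R) :=
  [set f | smooth_compact_support f /\ forall x, K x -> (1 <= f x)%R].

Definition capW_compact {R : realType} (K : set R) : \bar R :=
  ereal_inf [set 'N[@lebesgue_measure R]_1[EFin \o f^`()]
            | f in cap_admissible K].

Definition capB_compact {R : realType} (alpha q : R) (K : set R) : \bar R :=
  ereal_inf [set besov_seminorm1 alpha q f | f in cap_admissible K].

(* Extension of a set function on compact sets to open sets. *)
Definition cap_open {R : realType} (c : set R -> \bar R) (G : set R) : \bar R :=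
  ereal_sup [set c K | K in [set K : set R | K `<=` G /\ compact K]].

Definition capW_open {R : realType} (G : set R) : \bar R :=
  cap_open (@capW_compact R) G.

Definition capB_open {R : realType} (alpha q : R) (G : set R) : \bar R :=
  cap_open (capB_compact alpha q) G.

(* Main.v *)
Require Import Defs.
From HB Require Import structures.
From mathcomp Require Import all_boot all_order all_algebra.
From mathcomp Require Import all_classical all_reals all_analysis.
From mathcomp Require Import measurable_realfun ring lra.

Import Order.TTheory GRing.Theory Num.Theory.
Import numFieldNormedType.Exports.

Local Open Scope ring_scope.
Local Open Scope ereal_scope.
Local Open Scope classical_set_scope.

(** A compactly supported function that reaches the value 1 has to climb to 1
    and to come down again, so its total variation is at least 2
    ([integral_norm_derive_ge]).  Conversely, if [|x| <= M] on [K], the bump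
    [phi x = exp (1/s - 1/(M^2 + s - x^2))] on [x^2 < M^2 + s], extended by 0, is
    smooth, at least 1 on [K], even, nonincreasing in [|x|], and has maximum at
    most [exp (1/s)], hence total variation at most [2 exp (1/s)]
    ([smooth_bump], [integral_norm_unimodal]).  Letting [s] tend to infinity gives
    the value 2 of the capacities for [W_1^1].

    For the Besov capacities the same two variation lemmas are applied to
    [P x = F (x + h) - F x], where [F] is a primitive of [f]: its derivative
    [f (x + h) - f x] is the function integrated in the modulus of continuity.
    - Lower bound ([modulus_continuity1_ge]): if [f >= 1] on [[c, c + r]] and
      [0 <= h <= r], then [P c], the integral of [f] over [[c, c + h]], is at
      least [h], so that the modulus of continuity of [f] at [t <= r] is at least
      [2 t].
    - Upper bound ([modulus_continuity1_le]): for the bump, with maximum [m] and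
      support in [[- N, N]], evenness and monotonicity make [P] nondecreasing up
      to [- h / 2] and nonincreasing afterwards, with maximal value the integral of the
      bump over [[- h / 2, h / 2]]; hence the modulus of continuity at [t] is at
      most [2 m min(t, 2 N)].

    Integrating powers of [t] turns these bounds into bounds for the seminorm
    ([besov_seminorm1_ge], [besov_seminorm1_le]).  With [k = q^(-1/q)] the
    normalized capacity [(1 - alpha)^(1/q) cap (G; B)] lies between
    [2 k r^(1 - alpha)] and
    [2 exp (1/s) k (2 (M + s))^(1 - alpha) alpha^(-1/q)].  As [alpha] tends to 1
    these tend to [2 k] and [2 k exp (1/s)], and [s] is arbitrary. *)

Set Implicit Arguments.
Unset Strict Implicit.
Unset Printing Implicit Defensive.

(** * Smooth bumps *)

Section SmoothBump.
Local Open Scope ring_scope.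
Local Open Scope classical_set_scope.

(** The function [y^(-k) exp (-1/y)] on [y > 0], extended by 0: the building
    block of smooth functions that are flat at a point. *)
Definition flat_exp {R : realType} (k : nat) (y : R) : R :=
  if 0 < y then (y^-1) ^+ k * expR (- y^-1) else 0.

(** From [exp z >= z^(k+2) / (k+2)!] with [z = 1/y].  A quadratic bound is what
    makes [flat_exp k] derivable at 0, with derivative 0. *)
Lemma flat_exp_le_sqr {R : realType} k (y : R) :
  `|flat_exp k y| <= (k.+2)`!%:R * y ^+ 2.
Proof.
rewrite /flat_exp; case: ifPn => [y0|_]; last first.
  by rewrite normr0 mulr_ge0 ?sqr_ge0.
have z0 : 0 < y^-1 by rewrite invr_gt0.
rewrite ger0_norm; last by rewrite mulr_ge0 ?expR_ge0// exprn_ge0// ltW.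
have fact0 : 0 < (k.+2)`!%:R :> R by rewrite ltr0n fact_gt0.
have h : y^-1 ^+ k * y^-1 ^+ 2 <= expR y^-1 * (k.+2)`!%:R.
  rewrite -ler_pdivrMr// -exprD addn2.
  by rewrite (le_trans _ (expR_ge1Dxn k.+1 (ltW z0)))// lerDr.
rewrite expRN.
rewrite ler_pdivrMr ?expR_gt0//.
rewrite -(ler_pM2r (exprn_gt0 2 z0)) (le_trans h)//.
rewrite le_eqVlt; apply/orP; left; apply/eqP.
rewrite exprVn; field.
by rewrite gt_eqF.
Qed.

Lemma is_derive_flat_exp {R : realType} k (y : R) :
  is_derive y 1 (flat_exp k) (flat_exp k.+2 y - k%:R * flat_exp k.+1 y).
Proof.
have [y0|y0|->] := ltgtP y 0.
- rewrite /flat_exp ltNge (ltW y0)/= mulr0 subr0.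
  apply: (@near_eq_is_derive _ _ _ (cst 0)).
    near=> z; rewrite /= ltNge ifN// negbK ltW//.
    by near: z; exact: lt_nbhsl.
- have dV : is_derive y 1 (fun z : R => z^-1) (- y ^- 2 *: 1).
    by apply: (@is_deriveV _ id); rewrite gt_eqF.
  have dX := @is_deriveX _ _ _ k _ _ _ dV.
  have dE := @is_derive1_comp _ expR (fun z : R => - z^-1) y _ _ (is_derive_expR _)
    (is_deriveN dV).
  apply: near_eq_is_derive (is_derive_eq (is_deriveM dX dE) _).
    near=> z; rewrite /flat_exp ifT; first by rewrite !fctE.
    by near: z; exact: lt_nbhsr.
  rewrite /flat_exp y0 /= /GRing.scale /= !mulr1 opprK -exprVn.
  rewrite [(_ ^+ k) y](_ : _ = y^-1 ^+ k); last by rewrite exprfctE.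
  have -> : expR (- y^-1) * (k%:R * y^-1 ^+ k.-1 * - y^-1 ^+ 2) =
            - (k%:R * (y^-1 ^+ k.-1 * y^-1 ^+ 2 * expR (- y^-1))) by ring.
  congr (_ + _).
    by rewrite -(addn2 k) exprD; ring.
  by case: k {dX} => [|k]; rewrite ?mul0r//= -exprD addn2.
(* At 0: the slope [flat_exp k z / z] is at most [(k+2)! |z|]. *)
- have f0 j : flat_exp j 0 = 0 :> R by rewrite /flat_exp ltxx.
  rewrite !f0 mulr0 subr0.
  apply/is_derive1_caratheodory; exists (fun z => flat_exp k z / z); split.
  + move=> z; rewrite f0 !subr0; have [->|z0] := eqVneq z 0.
      by rewrite f0 mulr0.
    by rewrite divfK.
  + suff cv : flat_exp k z / z @[z --> (0 : R)] --> (0 : R).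
      by rewrite /prop_for /continuous_at f0 mul0r.
    apply/cvgrPdist_le => e e0.
    have c0 : 0 < e / (k.+2)`!%:R by rewrite divr_gt0// ltr0n fact_gt0.
    near=> z.
    have zle : `|z| <= e / (k.+2)`!%:R by near: z; exact: (@nbhs0_le _ R^o _ c0).
    rewrite sub0r normrN.
    have [->|z0] := eqVneq z 0; first by rewrite f0 mul0r normr0 ltW.
    rewrite normrM normfV ler_pdivrMr ?normr_gt0//.
    rewrite (le_trans (flat_exp_le_sqr _ _))// -real_normK ?num_real//.
    rewrite expr2 mulrA ler_pM2r ?normr_gt0// mulrC -ler_pdivlMr ?ltr0n ?fact_gt0//.
  + by rewrite f0 mul0r.
Unshelve. all: by end_near. Qed.

(** Finite sums of products of a polynomial by some [flat_exp k] composed with a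
    fixed polynomial [u].  This class is stable under derivation, so that all its
    members are smooth. *)
Inductive flat_sum {R : realType} (u : {poly R}) : (R -> R) -> Prop :=
| flat_sum1 (p : {poly R}) (k : nat) :
    flat_sum u (fun x => p.[x] * flat_exp k u.[x])
| flat_sumD f g : flat_sum u f -> flat_sum u g -> flat_sum u (fun x => f x + g x).

Lemma flat_sum_derive {R : realType} (u : {poly R}) (f : R -> R) :
  flat_sum u f -> flat_sum u (f^`()) /\ forall x, derivable f x 1.
Proof.
suff H : flat_sum u f ->
    exists2 f', flat_sum u f' & forall x : R, is_derive x 1 f (f' x).
  move=> /H[f' Sf' df]; split; last by move=> x; exact: ex_derive.
  suff -> : f^`() = f' by [].
  by apply/funext => x; rewrite derive1E derive_val.
elim=> [p k|{}f g _ [f' Sf df] _ [g' Sg dg]].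
- exists (fun x => (p^`())%R.[x] * flat_exp k u.[x] +
      ((p * u^`()%R).[x] * flat_exp k.+2 u.[x] +
       (- k%:R *: (p * u^`()%R)).[x] * flat_exp k.+1 u.[x])).
    by do !apply: flat_sumD; exact: flat_sum1.
  move=> x.
  have dc := @is_derive1_comp _ (flat_exp k) (horner u) x _ _
    (is_derive_flat_exp k _) (is_derive_poly u x).
  apply: is_derive_eq (is_deriveM (is_derive_poly p x) dc) _.
  by rewrite /GRing.scale /= hornerZ !hornerM; ring.
- exists (fun x => f' x + g' x); first exact: flat_sumD.
  by move=> x; exact: is_deriveD.
Qed.

Lemma flat_sum_smooth {R : realType} (u : {poly R}) (f : R -> R) :
  flat_sum u f -> forall n x, derivable (f^`(n)) x 1.
Proof.
move=> Sf n; suff /flat_sum_derive[] : flat_sum u (f^`(n)) by [].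
by elim: n => // n /flat_sum_derive[].
Qed.

Lemma flat_exp0_nd {R : realType} (y z : R) :
  y <= z -> flat_exp 0 y <= flat_exp 0 z.
Proof.
rewrite /flat_exp !expr0 !mul1r => yz; case: ifPn => [y0|_]; last first.
  by case: ifP; rewrite ?expR_ge0.
have z0 := lt_le_trans y0 yz.
by rewrite z0 ler_expR lerN2 lef_pV2.
Qed.

(** Existence of smooth bumps that are at least 1 on [[- M, M]] and whose maximum
    is as close to 1 as wanted.  There is no plateau: the function is unimodal and
    almost flat on [[- M, M]] when [s] is large. *)
Lemma smooth_bump {R : realType} (M s : R) : 0 <= M -> 1 <= s ->
  exists phi : R -> R, [/\ smooth_compact_support phi,
    forall x, `|x| <= M -> 1 <= phi x,
    forall x, 0 <= phi x <= expR s^-1 /\ (M + s <= `|x| -> phi x = 0),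
    forall x y, `|x| <= `|y| -> phi y <= phi x &
    (forall x, x <= 0 -> 0 <= phi^`() x) /\
    (forall x, 0 <= x -> phi^`() x <= 0)].
Proof.
move=> M0 s1; have s0 : 0 < s by exact: lt_le_trans s1.
(* On [|x| <= M] the inner polynomial [u] is at least [s]. *)
pose u : {poly R} := (M ^+ 2 + s)%:P - 'X^2.
have uE x : u.[x] = M ^+ 2 + s - `|x| ^+ 2.
  by rewrite /u !hornerE/= real_normK ?num_real.
pose p := (expR (s^-1))%:P : {poly R}.
pose phi x := p.[x] * flat_exp 0 u.[x].
have phiE x : phi x = expR s^-1 * flat_exp 0 u.[x] by rewrite /phi hornerC.
have dphi x : phi^`() x = expR s^-1 * (flat_exp 2 u.[x] * - (2 * x)).
  have dc := @is_derive1_comp _ (flat_exp 0) (horner u) x _ _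
    (is_derive_flat_exp 0 _) (is_derive_poly u x).
  have := is_deriveM (is_derive_poly p x) dc.
  rewrite derive1E => /@derive_val ->.
  rewrite /GRing.scale /= [in LHS]/p derivC horner0 hornerC derivB derivC sub0r.
  rewrite derivXn hornerN hornerMn expr1 hornerX.
  ring.
have supp x : M + s <= `|x| -> phi x = 0.
  move=> h; rewrite phiE /flat_exp ifF ?mulr0//; apply/negbTE.
  rewrite -leNgt uE subr_le0.
  rewrite (@le_trans _ _ ((M + s) ^+ 2))//.
    (* [M^2 + s <= (M + s)^2], because [0 <= M] and [1 <= s]. *)
    rewrite sqrrD -subr_ge0.
    have -> : M ^+ 2 + M * s *+ 2 + s ^+ 2 - (M ^+ 2 + s) =
       M * s *+ 2 + s * (s - 1) by ring.
    by rewrite addr_ge0// ?mulrn_wge0// mulr_ge0// ?subr_ge0// ltW.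
  by rewrite ler_pXn2r// nnegrE ?addr_ge0// ltW.
have fe0 k (y : R) : 0 <= flat_exp k y.
  rewrite /flat_exp; case: ifPn => // y0.
  by rewrite mulr_ge0 ?expR_ge0// exprn_ge0// invr_ge0 ltW.
exists phi; split.
- split; first by apply: flat_sum_smooth; exact: flat_sum1.
  apply: (@subclosed_compact _ _ `[- (M + s), M + s]).
  + exact: closed_closure.
  + exact: segment_compact.
  + have -> : `[- (M + s), M + s]%classic = closure `[- (M + s), M + s]%classic.
      by apply/closure_id; exact: interval_closed.
    apply: closureS => x/= /eqP phix.
    rewrite in_itv/= -ler_norml leNgt; apply/negP => /ltW/supp.
    exact: phix.
- move=> x xM; rewrite phiE /flat_exp.
  have us : s <= u.[x].
    by rewrite uE addrAC lerDr subr_ge0 ler_pXn2r// nnegrE.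
  rewrite (lt_le_trans s0 us) expr0 mul1r -expRD -expR0 ler_expR subr_ge0.
  by rewrite lef_pV2// posrE (lt_le_trans s0 us).
- move=> x; split; last exact: supp.
  rewrite phiE mulr_ge0 ?expR_ge0//= ler_piMr ?expR_ge0//.
  rewrite /flat_exp; case: ifPn => // u0; rewrite expr0 mul1r -expR0 ler_expR.
  by rewrite lerNl oppr0 invr_ge0 ltW.
- move=> x y xy; rewrite !phiE ler_wpM2l ?expR_ge0//; apply: flat_exp0_nd.
  by rewrite !uE lerB// ler_pXn2r// nnegrE.
- split => x x0; rewrite dphi mulrA.
    by rewrite mulr_ge0 ?mulr_ge0 ?expR_ge0// oppr_ge0 pmulr_rle0.
  by rewrite mulr_ge0_le0 ?mulr_ge0 ?expR_ge0// oppr_le0 pmulr_rge0.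
Qed.
End SmoothBump.

(** * Total variation and primitives *)

Section Variation.
Local Open Scope ring_scope.
Local Open Scope classical_set_scope.

Lemma is_derive_continuous {R : realType} (F f : R -> R) :
  (forall x : R, is_derive x 1 F (f x)) -> continuous F.
Proof.
by move=> dF x; apply/differentiable_continuous/derivable1_diffP; exact: ex_derive.
Qed.

Lemma integral_derive {R : realType} (F f : R -> R) (a b : R) :
  a <= b -> (forall x : R, is_derive x 1 F (f x)) -> continuous f ->
  (\int[lebesgue_measure]_(x in `[a, b]) (f x)%:E = (F b - F a)%:E)%E.
Proof.
rewrite le_eqVlt => /predU1P[<-|ab] dF cf.
  by rewrite set_itv1 integral_set1 subrr.
have cF := is_derive_continuous dF.
rewrite (@continuous_FTC2 _ f F)//.
- exact: continuous_subspaceT.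
- split; first by move=> x _; exact: ex_derive.
  + by apply: cvg_at_right_filter; exact: cF.
  + by apply: cvg_at_left_filter; exact: cF.
- by move=> x _; rewrite derive1E derive_val.
Qed.

Lemma integral_itv_normD {R : realType} (f : R -> R) (a c b : R) :
  a <= c <= b -> continuous f ->
  (\int[lebesgue_measure]_(x in `[a, b]) `|f x|%:E =
   \int[lebesgue_measure]_(x in `[a, c]) `|f x|%:E +
   \int[lebesgue_measure]_(x in `[c, b]) `|f x|%:E)%E.
Proof.
move=> /andP[ac cb] cf.
have mf (D : set R) : measurable D -> measurable_fun D ((fun x => `|f x|%:E) : R -> \bar R).
  move=> mD; apply: measurable_funTS; apply/measurable_EFinP.
  by apply: measurableT_comp => //; exact: continuous_measurable_fun.
rewrite -[X in (_ + X)%E]integral_itv_obnd_cbnd; last exact: mf.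
rewrite -ge0_integral_setU//=; last 2 first.
- by apply: mf; exact: measurableU.
- rewrite disj_set2E; apply/eqP/seteqP; split=> // x /=.
  by rewrite !in_itv/= => -[/andP[_ xc] /andP[cx _]]; move: (le_lt_trans xc cx); rewrite ltxx.
congr integral; rewrite -itv_bndbnd_setU//; by rewrite bnd_simp.
Qed.

(** The total variation of a function that vanishes at [a] and [b] is at least
    twice each of its values in between. *)
Lemma integral_norm_derive_ge {R : realType} (F f : R -> R) (a b c : R) :
  a <= c <= b -> (forall x : R, is_derive x 1 F (f x)) -> continuous f ->
  F a = 0 -> F b = 0 ->
  ((2 * F c)%:E <= \int[lebesgue_measure]_x `|f x|%:E)%E.
Proof.
move=> acb dF cf Fa Fb; have /andP[ac cb] := acb.
have mf (D : set R) : measurable D -> measurable_fun D (EFin \o f).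
  move=> mD; apply: measurable_funTS; apply/measurable_EFinP.
  exact: continuous_measurable_fun.
have mfn : measurable_fun setT ((fun x => `|f x|%:E) : R -> \bar R).
  apply/measurable_EFinP/measurableT_comp => //.
  exact: continuous_measurable_fun.
have le_int (u v : R) : u <= v ->
    (`|F v - F u|%:E <= \int[lebesgue_measure]_(x in `[u, v]) `|f x|%:E)%E.
  move=> uv; have := @le_abse_integral _ _ _ lebesgue_measure `[u, v]%classic (EFin \o f)
    (measurable_itv _) (mf _ (measurable_itv _)).
  by rewrite (integral_derive uv dF cf).
rewrite (@le_trans _ _ (\int[lebesgue_measure]_(x in `[a, b]) `|f x|%:E)%E)//; last first.
  exact: ge0_subset_integral.
rewrite (integral_itv_normD acb cf) mulr_natl mulr2n EFinD leeD//.
  by rewrite (le_trans _ (le_int _ _ ac))// Fa subr0 lee_fin ler_norm.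
by rewrite (le_trans _ (le_int _ _ cb))// Fb sub0r normrN lee_fin ler_norm.
Qed.

(** Equality in the previous bound when the function is nondecreasing up to [c],
    nonincreasing afterwards, and 0 outside [[a, b]]. *)
Lemma integral_norm_unimodal {R : realType} (F f : R -> R) (a b c : R) :
  a <= c <= b -> (forall x : R, is_derive x 1 F (f x)) -> continuous f ->
  F a = 0 -> F b = 0 ->
  (forall x, x <= c -> 0 <= f x) -> (forall x, c <= x -> f x <= 0) ->
  (forall x, x < a -> f x = 0) -> (forall x, b < x -> f x = 0) ->
  (\int[lebesgue_measure]_x `|f x|%:E = (2 * F c)%:E)%E.
Proof.
move=> acb dF cf Fa Fb f0 f1 fa fb; have /andP[ac cb] := acb.
transitivity (\int[lebesgue_measure]_(x in `[a, b]) `|f x|%:E)%E.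
  rewrite [RHS]integral_mkcond; apply: eq_integral => x _.
  rewrite patchE; case: ifPn => // /negP xab; congr EFin.
  have [xa|ax] := ltP x a; first by rewrite fa ?normr0.
  have [bx|xb] := ltP b x; first by rewrite fb ?normr0.
  by exfalso; apply: xab; rewrite inE/= in_itv/= ax xb.
rewrite (integral_itv_normD acb cf) mulr_natl mulr2n EFinD; congr (_ + _)%E.
  rewrite -[F c]subr0 -Fa -(integral_derive ac dF cf).
  apply: eq_integral => x; rewrite inE/= in_itv/= => /andP[_ xc].
  by rewrite ger0_norm ?f0.
have dNF (x : R) : is_derive x 1 (- F) (- f x) by exact: is_deriveN.
have cNf : continuous (fun x => - f x) by move=> x; apply: cvgN; exact: cf.
have -> : F c = (- F) b - (- F) c by rewrite !fctE Fb oppr0 sub0r opprK.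
rewrite -(integral_derive cb dNF cNf).
apply: eq_integral => x; rewrite inE/= in_itv/= => /andP[cx _].
by rewrite ler0_norm ?f1.
Qed.

(** A continuous function that vanishes outside [[- A, A]] has a primitive on the
    whole line, constant on each side of the support. *)
Lemma primitive_compact_support {R : realType} (f : R -> R) (A : R) :
  continuous f -> (forall x, A < `|x| -> f x = 0) ->
  exists2 F : R -> R, forall x : R, is_derive x 1 F (f x) &
    (forall x, x <= - A -> F x = F (- A)) /\ (forall x, A <= x -> F x = F A).
Proof.
move=> cf f0.
have intf : lebesgue_measure.-integrable setT (EFin \o f).
  have : lebesgue_measure.-integrable `[- A, A] (EFin \o f).
    apply: continuous_compact_integrable; first exact: segment_compact.
    exact: continuous_subspaceT.
  rewrite integrable_mkcond//; apply: eq_integrable => // x _.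
  rewrite patchE; case: ifPn => // /negP xA /=.
  rewrite f0// ltNge; apply/negP => xA'; apply: xA.
  by rewrite inE/= in_itv/= -ler_norml.
pose F x := (\int[lebesgue_measure]_(t in `]-oo, x]) f t)%R.
have dF (x : R) : is_derive x 1 F (f x).
  have [||||dFx Fx] := @continuous_FTC1 R f -oo%O x (x + 1).
  - by rewrite ltrDl.
  - exact: integrableS intf.
  - by rewrite ltNyr.
  - exact: cf.
  by apply: DeriveDef => //; rewrite -derive1E.
have cstF (u v : R) : u <= v -> (forall x, u < x < v -> f x = 0) -> F u = F v.
  rewrite le_eqVlt => /predU1P[->//|uv fuv].
  have [|x xuv] := @MVT _ F f u v uv.
    by apply: continuous_subspaceT; exact: is_derive_continuous dF.
  rewrite fuv; last by move: xuv; rewrite in_itv.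
  by rewrite mul0r => /eqP; rewrite subr_eq0 => /eqP.
exists F => //; split => x xA.
- apply: cstF => // y /andP[_ yA]; apply: f0.
  by rewrite -normrN (lt_le_trans _ (ler_norm _))// ltrNr.
- by apply/esym/cstF => // y /andP[Ay _]; apply: f0; rewrite (lt_le_trans Ay)// ler_norm.
Qed.

Lemma derive_bounded_growth {R : realType} (F f : R -> R) (m u v : R) :
  (forall x : R, is_derive x 1 F (f x)) -> u <= v ->
  (forall x, u < x < v -> f x <= m) -> F v - F u <= m * (v - u).
Proof.
move=> dF; rewrite le_eqVlt => /predU1P[->|uv fm]; first by rewrite !subrr mulr0.
have [|x xuv ->] := @MVT _ F f u v uv.
  by apply: continuous_subspaceT; exact: is_derive_continuous dF.
by rewrite ler_pM2r ?subr_gt0// fm//; move: xuv; rewrite in_itv.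
Qed.
End Variation.

(** * Bounds for the Sobolev capacity *)

Section Modulus.
Local Open Scope ring_scope.
Local Open Scope classical_set_scope.

Lemma compact_support_bound {R : realType} (f : R -> R) :
  smooth_compact_support f -> exists2 A : R, 0 < A & forall x, A < `|x| -> f x = 0.
Proof.
move=> [_ /compact_bounded [M [_ bM]]].
pose A := Num.max M 0 + 1.
have MA : M < A by rewrite (le_lt_trans (_ : M <= Num.max M 0))// ?le_max ?lexx// ltrDl.
exists A; first by rewrite ltr_wpDl// le_max lexx orbT.
move=> x; rewrite ltNge => xA; apply/eqP; apply: contraNT xA => fx.
exact/(bM _ MA)/subset_closure.
Qed.

(** The regularity of [f] that is used below, extracted from smoothness. *)
Lemma smooth_is_derive {R : realType} (f : R -> R) :
  smooth_compact_support f ->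
  [/\ forall x : R, is_derive x 1 f (f^`() x), continuous f & continuous f^`()].
Proof.
move=> [df _].
have df0 (x : R) : is_derive x 1 f (f^`() x).
  by rewrite derive1E; apply: derivableP; exact: (df 0%N).
split => //; first exact: is_derive_continuous df0.
by move=> x; apply/differentiable_continuous/derivable1_diffP; exact: (df 1%N).
Qed.

Lemma capW_compact_ge2 {R : realType} (K : set R) :
  K !=set0 -> (2%:E <= capW_compact K)%E.
Proof.
move=> [c Kc]; apply: le_ereal_inf_tmp => _ /= [f [sf f1] <-].
have [df _ cf'] := smooth_is_derive sf; have [A A0 fA] := compact_support_bound sf.
pose B := Num.max A `|c| + 1.
have AB : A < B by rewrite (le_lt_trans (_ : A <= Num.max A `|c|)) ?le_max ?lexx// ltrDl.
have cB : `|c| <= B.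
  by rewrite (le_trans (_ : _ <= Num.max A `|c|)) ?le_max ?lexx ?orbT// lerDl.
have B0 : 0 < B := lt_trans A0 AB.
rewrite Lnorm1 (le_trans _ (@integral_norm_derive_ge _ f f^`() (- B) B c _ df cf' _ _))//.
- by rewrite lee_fin ler_peMr// f1.
- by rewrite -ler_norml.
- by rewrite fA// normrN gtr0_norm.
- by rewrite fA// gtr0_norm.
Qed.

Lemma capW_compact_le {R : realType} (K : set R) (M s : R) :
  0 <= M -> 1 <= s -> (forall x, K x -> `|x| <= M) ->
  (capW_compact K <= (2 * expR s^-1)%:E)%E.
Proof.
move=> M0 s1 KM.
have [phi [sphi phi1 phib _ [dphi0 dphi1]]] := smooth_bump M0 s1.
have [df cf cf'] := smooth_is_derive sphi.
have s0 : 0 < s by exact: lt_le_trans s1.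
pose N := M + s; have N0 : 0 < N by rewrite /N ltr_wpDl.
have phiN x : N <= `|x| -> phi x = 0 by case: (phib x).
apply: ge_ereal_inf; exists ('N[@lebesgue_measure R]_1[EFin \o phi^`()])%E.
  by exists phi => //; split => // x /KM/phi1.
rewrite Lnorm1 (@integral_norm_unimodal _ phi phi^`() (- N) N 0)//.
- by rewrite lee_fin ler_pM2l//; have [/andP[]] := phib 0.
- by rewrite oppr_le0 ltW//= ltW.
- by rewrite phiN// normrN ler_norm.
- by rewrite phiN// ler_norm.
- move=> x xN; rewrite derive1E (@near_eq_derive _ _ _ _ (cst 0)) ?derive_val//.
  near=> y; rewrite phiN//= -normrN (le_trans _ (ler_norm _))// lerNr ltW//.
  by near: y; exact: lt_nbhsl.
- move=> x xN; rewrite derive1E (@near_eq_derive _ _ _ _ (cst 0)) ?derive_val//.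
  near=> y; rewrite phiN//= (le_trans _ (ler_norm _))// ltW//.
  by near: y; exact: lt_nbhsr.
Unshelve. all: by end_near. Qed.

Lemma expR_inv_near1 {R : realType} (e : R) : 0 < e ->
  exists2 s : R, 1 <= s & expR s^-1 <= 1 + e.
Proof.
move=> e0; have l0 : 0 < ln (1 + e) by rewrite ln_gt0// ltrDl.
exists (1 + (ln (1 + e))^-1); first by rewrite lerDl invr_ge0 ltW.
rewrite -[leRHS]lnK ?posrE ?addr_gt0// ler_expR.
rewrite -[leRHS]invrK lef_pV2 ?posrE ?invr_gt0 ?addr_gt0 ?invr_gt0//.
by rewrite lerDr.
Qed.

Lemma bounded_set_le {R : realType} (K : set R) :
  bounded_set K -> exists2 M : R, 0 <= M & forall x, K x -> `|x| <= M.
Proof.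
move=> [M [_ bM]]; exists (Num.max M 0 + 1).
  by rewrite addr_ge0// le_max lexx orbT.
move=> x Kx; apply: (bM (Num.max M 0 + 1)) => //.
by rewrite (le_lt_trans (_ : M <= Num.max M 0))// ?le_max ?lexx// ltrDl.
Qed.

Lemma capW_compact_le2 {R : realType} (K : set R) :
  compact K -> (capW_compact K <= 2%:E)%E.
Proof.
move=> /compact_bounded/bounded_set_le[M M0 KM].
apply/lee_addgt0Pr => e e0.
have [s s1 se] := @expR_inv_near1 _ (e / 2) (divr_gt0 e0 (ltr0n _ 2)).
rewrite (le_trans (capW_compact_le M0 s1 KM))// -EFinD lee_fin.
by rewrite -ler_pdivlMl// mulrDr mulVf// mulrC.
Qed.

Lemma open_itv_sub {R : realType} (G : set R) : open G -> G !=set0 ->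
  exists c r : R, 0 < r <= 1 /\ `[c, c + r]%classic `<=` G.
Proof.
move=> oG [c Gc]; have /nbhs_ballP[e /= e0 eG] := open_nbhs_nbhs (conj oG Gc).
exists c, (Num.min (e / 2) 1); split.
  by rewrite lt_min divr_gt0//= ltr01 ge_min lexx orbT.
move=> x; rewrite /= in_itv/= => /andP[cx xc]; apply: eG.
rewrite /ball/= distrC ger0_norm ?subr_ge0// ltrBlDl (le_lt_trans xc)//.
by rewrite ltrD2l gt_min ltr_pdivrMr// ltr_pMr// ltr1n.
Qed.

Lemma capW_open_eq2 {R : realType} (G : set R) :
  open G -> G !=set0 -> capW_open G = 2%:E.
Proof.
move=> oG G0; apply/eqP; rewrite eq_le; apply/andP; split.
  by apply: ge_ereal_sup => _ /= [K [_ cK] <-]; exact: capW_compact_le2.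
have [c [r [/andP[r0 _] cG]]] := open_itv_sub oG G0.
apply: le_trans (capW_compact_ge2 _) _; last first.
  apply: ereal_sup_ubound; exists `[c, c + r]%classic => //.
  by split=> //; exact: segment_compact.
by exists c; rewrite /= in_itv/= lexx lerDl ltW.
Qed.

(** * The modulus of continuity *)

Lemma primitive_shift {R : realType} (F f : R -> R) (h : R) :
  (forall x : R, is_derive x 1 F (f x)) ->
  forall x : R, is_derive x 1 (fun y => F (y + h) - F y) (f (x + h) - f x).
Proof.
move=> dF x; apply: is_deriveB.
have := @is_derive1_comp _ F (shift h) x _ _ (dF _) (is_derive_shift x 1 h).
by rewrite mulr1.
Qed.

Lemma continuous_diff_shift {R : realType} (f : R -> R) (h : R) :
  continuous f -> continuous (fun x => f (x + h) - f x).
Proof.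
move=> cf x; apply: cvgB; last exact: cf.
apply: (@cvg_comp _ _ _ (shift h) f); last exact: cf.
by apply: cvgD => //; exact: cvg_cst.
Qed.

Lemma modulus_continuity1_ge {R : realType} (f : R -> R) (c r t : R) :
  smooth_compact_support f -> (forall x, c <= x <= c + r -> 1 <= f x) ->
  0 <= t <= r -> ((2 * t)%:E <= modulus_continuity1 f t)%E.
Proof.
move=> sf f1 /andP[t0 tr].
have [_ cf _] := smooth_is_derive sf; have [A A0 fA] := compact_support_bound sf.
have [F dF [FA FB]] := primitive_compact_support cf fA.
pose P x := F (x + t) - F x.
pose B := Num.max A `|c| + t.
have AB : A + t <= B by rewrite lerD2r le_max lexx.
have cB : `|c| <= B by rewrite (le_trans (_ : _ <= Num.max A `|c|)) ?le_max ?lexx ?orbT// lerDl.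
have AB' : A <= B by rewrite (le_trans _ AB)// lerDl.
have dP := primitive_shift t dF.
have PmB : P (- B) = 0 by rewrite /P !FA ?subrr//; lra.
have PB : P B = 0 by rewrite /P !FB ?subrr//; lra.
have cP := continuous_diff_shift (h := t) cf.
apply: (@le_trans _ _ (2 * P c)%:E).
  rewrite lee_fin ler_pM2l// /P.
  (* [P c >= t], as the derivative of [F] is at least 1 on [[c, c + t]]. *)
  have dNF (x : R) : is_derive x 1 (- F) (- f x) by exact: is_deriveN.
  have := @derive_bounded_growth _ (- F) (fun x => - f x) (-1) c (c + t) dNF.
  rewrite !fctE addrAC subrr add0r => /(_ _ _)/[!lerDl]/(_ t0).
  have fm x : c < x < c + t -> - f x <= -1.
    move=> /andP[cx xc]; rewrite lerN2 f1// ltW//= (le_trans (ltW xc))//.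
    by rewrite lerD2l.
  by move=> /(_ fm); lra.
rewrite (le_trans (@integral_norm_derive_ge _ P _ (- B) B c _ dP cP PmB PB))//.
  by rewrite -ler_norml.
apply: ereal_sup_ubound; exists t => //=.
by rewrite t0 lexx.
Qed.

Lemma modulus_continuity1_le {R : realType} (f : R -> R) (m N t : R) :
  smooth_compact_support f -> 0 <= N ->
  (forall x, 0 <= f x <= m) -> (forall x, N <= `|x| -> f x = 0) ->
  (forall x y, `|x| <= `|y| -> f y <= f x) -> 0 <= t ->
  (modulus_continuity1 f t <= (2 * m * Num.min t (2 * N))%:E)%E.
Proof.
move=> sf N0 fm fN fdec t0; apply: ge_ereal_sup => _ /= [h /andP[h0 ht] <-].
have [_ cf _] := smooth_is_derive sf.
have m0 : 0 <= m by have /andP[/le_trans] := fm 0; apply.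
have [F dF [FA FB]] := primitive_compact_support cf (fun x xN => fN x (ltW xN)).
pose P x := F (x + h) - F x.
have dP := primitive_shift h dF.
have cP := continuous_diff_shift (h := h) cf.
(* [x + h] is closer to 0 than [x] exactly when [x < - h / 2]. *)
rewrite (@integral_norm_unimodal _ P _ (- (N + h)) (N + h) (- (h / 2)))//; first last.
- move=> x xN; rewrite !fN ?subrr//.
    by rewrite (le_trans _ (ler_norm _))//; lra.
  by rewrite (le_trans _ (ler_norm _))//; lra.
- move=> x xN; rewrite !fN ?subrr//.
    by rewrite -normrN (le_trans _ (ler_norm _))//; lra.
  by rewrite -normrN (le_trans _ (ler_norm _))//; lra.
- move=> x hx; rewrite subr_le0; apply: fdec.
  by rewrite [leRHS]ger0_norm ?ler_norml; lra.
- move=> x hx; rewrite subr_ge0; apply: fdec.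
  by rewrite [leRHS]ler0_norm ?ler_norml; lra.
- by rewrite /P !FB ?subrr//; lra.
- by rewrite /P !FA ?subrr//; lra.
- by lra.
rewrite lee_fin -mulrA ler_pM2l// /P.
have -> : - (h / 2) + h = h / 2 by lra.
have step u v : u <= v -> F v - F u <= m * (v - u).
  by move=> uv; apply: (derive_bounded_growth dF) => // x _; have /andP[] := fm x.
rewrite minr_pMr// le_min; apply/andP; split.
  rewrite (le_trans (step _ _ _))//; first by lra.
  by rewrite ler_wpM2l//; lra.
have [hN|Nh] := leP (h / 2) N.
  rewrite (le_trans (step _ _ _))//; first by lra.
  by rewrite ler_wpM2l//; lra.
rewrite (FB (h / 2)) ?(ltW Nh)// (FA (- (h / 2))) ?lerN2 ?(ltW Nh)//.
rewrite (le_trans (step _ _ _))//; first by lra.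
by rewrite ler_wpM2l//; lra.
Qed.
End Modulus.

(** * Bounds for the Besov seminorm *)

Section BesovBounds.
Local Open Scope ring_scope.
Local Open Scope classical_set_scope.

(** Monotonicity of the integral of nonnegative functions in both the domain and
    the integrand.  No measurability is needed, as such an integral is a supremum
    over the simple functions below the integrand; this spares a proof that
    [modulus_continuity1 f] is measurable. *)
Lemma ge0_le_integral_sub d (T : measurableType d) (R : realType)
    (mu : {measure set T -> \bar R}) (A B : set T) (f g : T -> \bar R) :
  A `<=` B -> (forall x, A x -> 0 <= f x <= g x)%E -> (forall x, B x -> 0 <= g x)%E ->
  (\int[mu]_(x in A) f x <= \int[mu]_(x in B) g x)%E.
Proof.
move=> AB fg g0; rewrite integral_mkcond [leRHS]integral_mkcond.
have f0 x : A x -> (0 <= f x)%E by move=> /fg/andP[].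
rewrite !ge0_integralTE; last 2 first.
- exact: erestrict_ge0.
- exact: erestrict_ge0.
apply: ereal_sup_le => _ [h hf <-]; exists h => // x.
apply: (le_trans (hf x)); rewrite !patchE; case: ifPn => [|_].
  by rewrite inE => Ax; rewrite mem_set; [have /andP[] := fg _ Ax|exact: AB].
by case: ifPn => // /set_mem/g0.
Qed.

Lemma ge0_integral_bigcup_le d (T : measurableType d) (R : realType)
    (mu : {measure set T -> \bar R}) (F : (set T)^nat) (f : T -> \bar R) (l : \bar R) :
  nondecreasing_seq F -> (forall i, measurable (F i)) ->
  (forall i, measurable_fun (F i) f) -> (forall i x, F i x -> 0 <= f x)%E ->
  (forall i, \int[mu]_(x in F i) f x <= l)%E ->
  (\int[mu]_(x in \bigcup_i F i) f x <= l)%E.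
Proof.
move=> ndF mF mf f0 Fl.
have cF := @ge0_nondecreasing_set_cvg_integral _ _ _ F f mu ndF mF mf f0.
rewrite -(cvg_lim _ cF)//; apply: lime_le; first exact: (cvgP _ cF).
exact: nearW.
Qed.

Lemma integral_powR_segment {R : realType} (a u v : R) :
  a != 0 -> 0 < u -> u <= v ->
  (\int[lebesgue_measure]_(t in `[u, v]) (t `^ (a - 1))%:E =
   ((v `^ a - u `^ a) / a)%:E)%E.
Proof.
move=> a0 u0; rewrite le_eqVlt => /predU1P[<-|uv].
  by rewrite set_itv1 integral_set1 subrr mul0r.
have dP b (x : R) : 0 < x -> {for x, continuous (fun t : R => t `^ b)}.
  move=> x0; apply/differentiable_continuous/derivable1_diffP.
  by apply: ex_derive; exact: is_derive1_powR.
pose F t : R := a^-1 * t `^ a.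
have dF (x : R) : 0 < x -> is_derive x 1 F (x `^ (a - 1)).
  move=> x0; have := is_derive1_powR a x0.
  move=> /(@is_deriveZ _ _ _ _ a^-1); rewrite /GRing.scale/= mulrA mulVf// mul1r.
  exact.
have cF (x : R) : 0 < x -> {for x, continuous F}.
  move=> x0; apply/differentiable_continuous/derivable1_diffP.
  by apply: ex_derive; exact: dF.
have v0 := lt_trans u0 uv.
rewrite (@continuous_FTC2 _ _ F)//.
- by rewrite -EFinB /F -mulrBr mulrC.
- apply: continuous_in_subspaceT => x; rewrite inE/= in_itv/= => /andP[ux _].
  exact/dP/(lt_le_trans u0).
- split.
  + move=> x; rewrite in_itv/= => /andP[ux _].
    by apply: ex_derive; exact: dF (lt_trans u0 ux).
  + by apply: cvg_at_right_filter; exact: cF.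
  + by apply: cvg_at_left_filter; exact: cF.
- move=> x; rewrite in_itv/= => /andP[ux _].
  by rewrite derive1E; have [_ ->] := dF _ (lt_trans u0 ux).
Qed.

Lemma measurable_powR_EFin {R : realType} (b : R) (D : set R) :
  measurable_fun D (fun t : R => (t `^ b)%:E).
Proof.
by apply: measurable_funTS; apply/measurable_EFinP; exact: measurable_powR.
Qed.

Lemma integral_powR0 {R : realType} (a r : R) : 0 < a -> 0 < r ->
  (\int[lebesgue_measure]_(t in `]0%R, r]) (t `^ (a - 1))%:E = (r `^ a / a)%:E)%E.
Proof.
move=> a0 r0; have an0 : a != 0 by rewrite gt_eqF.
apply/eqP; rewrite eq_le; apply/andP; split.
  rewrite itv_open_bnd_bigcup; apply: ge0_integral_bigcup_le => //.
  - apply/nondecreasing_seqP => n; rewrite subsetEset; apply: subset_itvr.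
    by rewrite bnd_simp !add0r lef_pV2 ?posrE ?ltr0n// ler_nat.
  - by move=> n; exact: measurable_powR_EFin.
  - by move=> n x _; rewrite lee_fin powR_ge0.
  - move=> n; rewrite add0r; have [nr|rn] := leP (n.+1%:R^-1) r.
      rewrite integral_powR_segment ?invr_gt0 ?ltr0n// lee_fin.
      by rewrite ler_pM2r ?invr_gt0// lerBlDr lerDl powR_ge0.
    by rewrite set_itv_ge ?integral_set0 ?lee_fin ?divr_ge0 ?powR_ge0 ?(ltW a0)// bnd_simp -ltNge.
apply/lee_addgt0Pr => e e0.
(* For the lower bound, integrate over [[u, r]] only, with [u] so small that
   [u^a / a <= e]. *)
pose u := Num.min r ((e * a) `^ a^-1).
have ea0 : 0 < e * a by rewrite mulr_gt0.
have u0 : 0 < u by rewrite lt_min r0 powR_gt0.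
have ur : u <= r by rewrite ge_min lexx.
have uea : u `^ a <= e * a.
  rewrite (le_trans (y := ((e * a) `^ a^-1) `^ a))//.
    by rewrite ge0_ler_powR ?nnegrE ?(ltW u0) ?(ltW a0) ?powR_ge0// ge_min lexx orbT.
  by rewrite -powRrM mulVf// powRr1// ltW.
rewrite -leeBlDr//; apply: le_trans (_ : (((r `^ a - u `^ a) / a)%:E <= _)%E).
  by rewrite -EFinB lee_fin mulrBl lerB// ler_pdivrMr.
rewrite -integral_powR_segment//; apply: ge0_le_integral_sub.
- by apply: subset_itvr; rewrite bnd_simp.
- by move=> x _; rewrite lexx lee_fin powR_ge0.
- by move=> x _; rewrite lee_fin powR_ge0.
Qed.

Lemma integral_powRy_le {R : realType} (b r : R) : 0 < b -> 0 < r ->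
  (\int[lebesgue_measure]_(t in `]r, +oo[) (t `^ (- b - 1))%:E <=
   (r `^ (- b) / b)%:E)%E.
Proof.
move=> b0 r0; have bn0 : - b != 0 by rewrite oppr_eq0 gt_eqF.
rewrite integral_itv_obnd_cbnd; last exact: measurable_powR_EFin.
rewrite itv_bndy_bigcup_BRight; apply: ge0_integral_bigcup_le => //.
- apply/nondecreasing_seqP => n; rewrite subsetEset; apply: subset_itvl.
  by rewrite bnd_simp lerD2l ler_nat.
- by move=> n; exact: measurable_powR_EFin.
- by move=> n x _; rewrite lee_fin powR_ge0.
- move=> n; rewrite integral_powR_segment ?lerDl ?ler0n// lee_fin.
  rewrite invrN mulrN -mulNr opprB ler_pM2r ?invr_gt0//.
  by rewrite lerBlDr lerDl powR_ge0.
Qed.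

Lemma powR_scale_linear {R : realType} (alpha q c t : R) :
  0 < t -> 0 <= c ->
  (t `^ (- alpha) * (c * t)) `^ q * t^-1 = c `^ q * t `^ (q * (1 - alpha) - 1).
Proof.
move=> t0 c0; rewrite mulrCA.
have -> : t `^ (- alpha) * t = t `^ (1 - alpha).
  by rewrite -{2}(powRr1 (ltW t0)) -powRD 1?addrC// (gt_eqF t0) implybT.
rewrite powRM// ?powR_ge0// -powRrM -mulrA; congr (_ * _).
by rewrite mulrC powRD ?(gt_eqF t0) ?implybT// powR_inv1 ?(ltW t0)// mulrC [_ * q]mulrC.
Qed.

Lemma powR_scale_const {R : realType} (alpha q c t : R) :
  0 < t -> 0 <= c ->
  (t `^ (- alpha) * c) `^ q * t^-1 = c `^ q * t `^ (- (alpha * q) - 1).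
Proof.
move=> t0 c0; rewrite powRM ?powR_ge0// -powRrM mulNr [c `^ q * _]mulrC.
rewrite mulrAC powRD ?(gt_eqF t0) ?implybT// powR_inv1 ?(ltW t0)//.
Qed.

Lemma besov_seminorm1_ge {R : realType} (alpha q r : R) (f : R -> R) :
  alpha < 1 -> 0 < q -> 0 < r ->
  (forall t, 0 <= t <= r -> ((2 * t)%:E <= modulus_continuity1 f t)%E) ->
  (((2 `^ q * (r `^ (q * (1 - alpha)) / (q * (1 - alpha)))) `^ q^-1)%:E <=
   besov_seminorm1 alpha q f)%E.
Proof.
move=> a1 q0 r0 fr; have a0 : 0 < q * (1 - alpha) by rewrite mulr_gt0// subr_gt0.
have qV0 : 0 <= q^-1 by rewrite invr_ge0 ltW.
rewrite /besov_seminorm1 -poweR_EFin.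
apply: gt0_ler_poweR => //.
- by rewrite in_itv/= leey andbT lee_fin mulr_ge0 ?powR_ge0// divr_ge0 ?powR_ge0 ?ltW.
- rewrite in_itv/= leey andbT; apply: integral_ge0 => t.
  by rewrite /= in_itv/= andbT => t0; rewrite mule_ge0 ?poweR_ge0// lee_fin invr_ge0 ltW.
rewrite EFinM -(integral_powR0 a0 r0) -ge0_integralZl_EFin//; last 2 first.
- by move=> t _; rewrite lee_fin powR_ge0.
- exact: measurable_powR_EFin.
apply: ge0_le_integral_sub.
- by apply: subset_itvl; rewrite bnd_simp.
- move=> t; rewrite /= in_itv/= => /andP[t0 tr].
  rewrite -EFinM lee_fin mulr_ge0 ?powR_ge0//=.
  rewrite -(powR_scale_linear _ _ t0)// EFinM lee_pmul//.
  + by rewrite lee_fin powR_ge0.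
  + by rewrite lee_fin invr_ge0 ltW.
  rewrite -poweR_EFin; apply: gt0_ler_poweR.
  + exact: ltW.
  + by rewrite in_itv/= leey andbT lee_fin mulr_ge0 ?powR_ge0// mulr_ge0// ltW.
  + rewrite in_itv/= leey andbT mule_ge0// ?lee_fin ?powR_ge0//.
    by rewrite (le_trans _ (fr _ _)) ?lee_fin ?mulr_ge0 ?(ltW t0).
  + by rewrite EFinM lee_wpmul2l ?lee_fin ?powR_ge0// fr// (ltW t0).
- move=> t; rewrite /= in_itv/= andbT => t0.
  by rewrite mule_ge0 ?poweR_ge0// lee_fin invr_ge0 ltW.
Qed.

Lemma modulus_continuity1_ge0 {R : realType} (f : R -> R) (t : R) :
  0 <= t -> (0 <= modulus_continuity1 f t)%E.
Proof.
move=> t0; apply: le_ereal_sup_tmp.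
exists (\int[@lebesgue_measure R]_x `|f (x + 0)%R - f x|%:E)%E.
  by exists 0 => //=; rewrite lexx.
exact: integral_ge0.
Qed.

Lemma besov_seminorm1_le {R : realType} (alpha q c T : R) (f : R -> R) :
  0 < alpha < 1 -> 0 < q -> 0 < T -> 0 <= c ->
  (forall t, 0 <= t -> (modulus_continuity1 f t <= (c * Num.min t T)%:E)%E) ->
  (besov_seminorm1 alpha q f <=
   ((c `^ q * (T `^ (q * (1 - alpha)) / (q * alpha * (1 - alpha)))) `^ q^-1)%:E)%E.
Proof.
move=> /andP[a0 a1] q0 T0 c0 fc.
have b0 : 0 < q * (1 - alpha) by rewrite mulr_gt0// subr_gt0.
have aq0 : 0 < alpha * q by rewrite mulr_gt0.
have a1' : 0 < 1 - alpha by rewrite subr_gt0.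
have qV0 : 0 <= q^-1 by rewrite invr_ge0 ltW.
rewrite /besov_seminorm1 -poweR_EFin.
have int0 t : 0 < t ->
    (0 <= ((t `^ (- alpha))%:E * modulus_continuity1 f t) `^ q * (t^-1)%:E)%E.
  by move=> t0; rewrite mule_ge0 ?poweR_ge0// lee_fin invr_ge0 ltW.
apply: gt0_ler_poweR => //.
- rewrite in_itv/= leey andbT; apply: integral_ge0 => t.
  by rewrite /= in_itv/= andbT; exact: int0.
- rewrite in_itv/= leey andbT lee_fin mulr_ge0 ?powR_ge0// divr_ge0 ?powR_ge0//.
  by rewrite mulr_ge0 ?mulr_ge0// ltW.
(* A measurable majorant of the integrand, on [t > 0]; there [t^(-1)] written
   with [powR] is the inverse of [t]. *)
pose H (t : R) : R := (t `^ (- alpha) * (c * Num.min t T)) `^ q * t `^ (-1).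
have mH (D : set R) : measurable_fun D (EFin \o H).
  apply: measurable_funTS; apply/measurable_EFinP; apply: measurable_funM.
    apply: (measurableT_comp (measurable_powR q)).
    apply: measurable_funM; first exact: measurable_powR.
    by apply: measurable_funM => //; apply: measurable_minr.
  exact: measurable_powR.
have H0 (t : R) : (0 <= (H t)%:E)%E by rewrite lee_fin mulr_ge0 ?powR_ge0.
apply: (@le_trans _ _ (\int[lebesgue_measure]_(t in `]0%R, +oo[) (H t)%:E)%E).
  apply: ge0_le_integral_sub => // t; rewrite /= in_itv/= andbT => t0.
  rewrite int0//= /H powR_inv1 ?(ltW t0)// EFinM lee_wpmul2r ?lee_fin ?invr_ge0 ?(ltW t0)//.
  rewrite -[leRHS]poweR_EFin; apply: gt0_ler_poweR.
  - exact: ltW.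
  - by rewrite in_itv/= leey andbT mule_ge0// ?lee_fin ?powR_ge0// modulus_continuity1_ge0// ltW.
  - by rewrite in_itv/= leey andbT lee_fin mulr_ge0 ?powR_ge0// mulr_ge0// le_min !ltW.
  - by rewrite EFinM lee_wpmul2l ?lee_fin ?powR_ge0// fc// ltW.
have -> : `]0%R, +oo[%classic = `]0, T] `|` `]T, +oo[ :> set R.
  by apply: itv_bndbnd_setU; rewrite bnd_simp// ltW.
rewrite ge0_integral_setU//=; last 2 first.
- exact: mH.
- rewrite disj_set2E; apply/eqP/seteqP; split=> // x /=.
  by rewrite !in_itv/= andbT => -[/andP[_ xT]]; rewrite ltNge xT.
have -> : (\int[lebesgue_measure]_(t in `]0%R, T]) (H t)%:E =
    (c `^ q)%:E * \int[lebesgue_measure]_(t in `]0%R, T]) (t `^ (q * (1 - alpha) - 1))%:E)%E.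
  rewrite -ge0_integralZl_EFin ?powR_ge0//.
  - apply: eq_integral => t; rewrite inE/= in_itv/= => /andP[t0 tT].
    by rewrite /H min_l// powR_inv1 ?(ltW t0)// powR_scale_linear.
  - by move=> t _; rewrite lee_fin powR_ge0.
  - exact: measurable_powR_EFin.
have -> : (\int[lebesgue_measure]_(t in `]T, +oo[) (H t)%:E =
    ((c * T) `^ q)%:E * \int[lebesgue_measure]_(t in `]T, +oo[) (t `^ (- (alpha * q) - 1))%:E)%E.
  rewrite -ge0_integralZl_EFin ?powR_ge0//.
  - apply: eq_integral => t; rewrite inE/= in_itv/= andbT => tT.
    have t0 := lt_trans T0 tT.
    by rewrite /H min_r ?ltW// powR_inv1 ?(ltW t0)// powR_scale_const// mulr_ge0// ltW.
  - by move=> t _; rewrite lee_fin powR_ge0.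
  - exact: measurable_powR_EFin.
rewrite integral_powR0//.
apply: (@le_trans _ _ ((c `^ q)%:E * (T `^ (q * (1 - alpha)) / (q * (1 - alpha)))%:E +
   ((c * T) `^ q)%:E * (T `^ (- (alpha * q)) / (alpha * q))%:E)%E).
  by rewrite leeD2l// lee_wpmul2l ?lee_fin ?powR_ge0// integral_powRy_le.
rewrite -!EFinM -EFinD lee_fin powRM ?(ltW T0)//.
have -> : c `^ q * T `^ q * (T `^ (- (alpha * q)) / (alpha * q)) =
          c `^ q * (T `^ (q * (1 - alpha)) / (alpha * q)).
  rewrite -!mulrA; congr (_ * _); rewrite mulrA; congr (_ / _).
  rewrite -powRD ?(gt_eqF T0) ?implybT//; congr (_ `^ _); ring.
(* [1 / (1 - alpha) + 1 / alpha = 1 / (alpha (1 - alpha))] *)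
rewrite le_eqVlt; apply/orP; left; apply/eqP; field.
by rewrite !gt_eqF.
Qed.
End BesovBounds.

(** * The limit of the Besov capacities *)

Section CapacityLimit.
Local Open Scope ring_scope.
Local Open Scope classical_set_scope.

(** The factor [d^(1/q)] cancels the singularity [1/d] of the integral bounds, to
    be used with [d = 1 - alpha]. *)
Lemma powR_normalization {R : realType} (q d k x y : R) :
  0 < q -> 0 < d -> 0 < k -> 0 <= x -> 0 <= y ->
  d `^ q^-1 * (x `^ q * (y `^ (q * d) / (k * d))) `^ q^-1 =
  x * y `^ d * k `^ (- q^-1).
Proof.
move=> q0 d0 k0 x0 y0.
have qn0 : q != 0 by rewrite gt_eqF.
rewrite -powRM; [|exact: ltW|]; last first.
  by rewrite mulr_ge0 ?powR_ge0// divr_ge0 ?powR_ge0// mulr_ge0// ltW.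
have -> : d * (x `^ q * (y `^ (q * d) / (k * d))) = x `^ q * y `^ (q * d) * k^-1.
  by field; rewrite !gt_eqF.
rewrite !powRM ?mulr_ge0 ?powR_ge0 ?invr_ge0 ?(ltW k0)//.
rewrite -!powRrM mulfV// powRr1// (mulrAC q d) mulfV// mul1r.
by rewrite -powR_inv1 ?(ltW k0)// -powRrM mulN1r.
Qed.

Lemma capB_open_ge {R : realType} (G : set R) (alpha q c r : R) :
  0 < q -> alpha < 1 -> 0 < r -> `[c, c + r]%classic `<=` G ->
  ((2 * r `^ (1 - alpha) * q `^ (- q^-1))%:E <=
   ((1 - alpha) `^ q^-1)%:E * capB_open alpha q G)%E.
Proof.
move=> q0 a1 r0 cG; have d0 : 0 < 1 - alpha by rewrite subr_gt0.
rewrite -(@powR_normalization _ q _ q) ?(ltW r0)// EFinM.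
apply: lee_wpmul2l; first by rewrite lee_fin powR_ge0.
apply: (@le_trans _ _ (capB_compact alpha q `[c, c + r]%classic)); last first.
  apply: ereal_sup_ubound; exists `[c, c + r]%classic => //.
  by split => //; exact: segment_compact.
apply: le_ereal_inf_tmp => _ [f [sf f1] <-].
apply: besov_seminorm1_ge => // t.
apply: (modulus_continuity1_ge (c := c) sf) => x xc.
by apply: f1; rewrite /= in_itv.
Qed.

Lemma capB_open_le {R : realType} (G : set R) (alpha q M s : R) :
  0 < q -> 0 < alpha < 1 -> 0 <= M -> 1 <= s -> (forall x, G x -> `|x| <= M) ->
  (((1 - alpha) `^ q^-1)%:E * capB_open alpha q G <=
   (2 * expR s^-1 * (2 * (M + s)) `^ (1 - alpha) * (q * alpha) `^ (- q^-1))%:E)%E.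
Proof.
move=> q0 /andP[a0 a1] M0 s1 GM; have d0 : 0 < 1 - alpha by rewrite subr_gt0.
have s0 : 0 < s by exact: lt_le_trans s1.
have N0 : 0 < M + s by rewrite ltr_wpDl.
have [phi [sphi phi1 phib phidec _]] := smooth_bump M0 s1.
rewrite -powR_normalization ?mulr_gt0 ?mulr_ge0 ?expR_ge0 ?(ltW N0)// EFinM.
apply: lee_wpmul2l; first by rewrite lee_fin powR_ge0.
apply: ge_ereal_sup => _ [K [KG _] <-].
apply: ge_ereal_inf; exists (besov_seminorm1 alpha q phi).
  by exists phi => //; split => // x /KG/GM/phi1.
apply: besov_seminorm1_le; rewrite ?a0 ?mulr_gt0 ?mulr_ge0 ?expR_ge0//.
move=> t t0; apply: (modulus_continuity1_le sphi) => //; first exact: ltW.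
- by move=> x; have [] := phib x.
- by move=> x; have [] := phib x.
Qed.

Lemma powR_cvg_onem {R : realType} (y : R) : 0 < y ->
  y `^ (1 - a) @[a --> (1 : R)^'-] --> (1 : R).
Proof.
move=> y0; have -> : (fun a : R => y `^ (1 - a)) = (fun a => expR ((1 - a) * ln y)).
  by apply/funext => a; rewrite /powR gt_eqF.
rewrite -[X in _ --> X](_ : expR ((1 - 1) * ln y) = 1); last first.
  by rewrite subrr mul0r expR0.
apply: cvg_at_left_filter.
apply: (@cvg_comp _ _ _ (fun a : R => (1 - a) * ln y) expR); last exact: continuous_expR.
apply: cvgM; last exact: cvg_cst.
by apply: cvgB; [exact: cvg_cst|exact: cvg_id].
Qed.

Lemma powR_cvg_mull1 {R : realType} (q b : R) : 0 < q ->
  (q * a) `^ b @[a --> (1 : R)^'-] --> q `^ b.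
Proof.
move=> q0; apply: cvg_at_left_filter.
have cq : q * a @[a --> (1 : R)] --> q * 1.
  by apply: cvgM; [exact: cvg_cst|exact: cvg_id].
rewrite mulr1 in cq; have cp : {for q, continuous (fun x : R => x `^ b)}.
  apply/differentiable_continuous/derivable1_diffP.
  by apply: ex_derive; exact: is_derive1_powR.
exact: (@cvg_comp _ _ _ (fun a : R => q * a) (fun x : R => x `^ b) _ (nbhs q) _ cq cp).
Qed.

Lemma capB_open_cvg {R : realType} (G : set R) (q : R) :
  1 <= q -> open G -> G !=set0 -> bounded_set G ->
  (((1 - alpha) `^ q^-1)%:E * capB_open alpha q G)%E @[alpha --> (1 : R)^'-] -->
  (2 * q `^ (- q^-1))%:E.
Proof.
move=> q1 oG G0 /bounded_set_le[M M0 GM].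
have q0 : 0 < q by exact: lt_le_trans q1.
have [c [r [/andP[r0 _] cG]]] := open_itv_sub oG G0.
set k := q `^ (- q^-1); have k0 : 0 < k by exact: powR_gt0.
pose X alpha := (((1 - alpha) `^ q^-1)%:E * capB_open alpha q G)%E.
pose L alpha := 2 * r `^ (1 - alpha) * q `^ (- q^-1).
pose U s alpha :=
  2 * expR s^-1 * (2 * (M + s)) `^ (1 - alpha) * (q * alpha) `^ (- q^-1).
have XLU s : 1 <= s -> \forall alpha \near (1 : R)^'-,
    ((L alpha)%:E <= X alpha <= (U s alpha)%:E)%E.
  move=> s1; near=> alpha.
  have a1 : alpha < 1 by near: alpha; exact: nbhs_left_lt.
  have a0 : 0 < alpha by near: alpha; exact: nbhs_left_gt.
  by apply/andP; split; [exact: capB_open_ge cG|apply: capB_open_le; rewrite ?a0].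
have cL : L alpha @[alpha --> (1 : R)^'-] --> 2 * k.
  suff : L alpha @[alpha --> (1 : R)^'-] --> 2 * 1 * k by rewrite mulr1.
  apply: cvgM; last exact: cvg_cst.
  by apply: cvgM; [exact: cvg_cst|exact: powR_cvg_onem].
have cU s : 1 <= s -> U s alpha @[alpha --> (1 : R)^'-] --> 2 * expR s^-1 * k.
  move=> s1.
  suff : U s alpha @[alpha --> (1 : R)^'-] --> 2 * expR s^-1 * 1 * k by rewrite mulr1.
  apply: cvgM; last exact: powR_cvg_mull1.
  apply: cvgM; [exact: cvg_cst|apply: powR_cvg_onem].
  by rewrite mulr_gt0// ltr_wpDl// (lt_le_trans _ s1).
apply/fine_cvgP; split.
  have := XLU 1 (lexx _); apply: filterS => alpha /andP[LX XU].
  by rewrite fin_real// (lt_le_trans (ltNyr _) LX) (le_lt_trans XU (ltry _)).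
apply/cvgrPdist_le => e e0.
(* With this [s], the limit of the upper bound is at most [2 k + e / 2]. *)
have [s s1 se] := @expR_inv_near1 _ (e / (4 * k)) (divr_gt0 e0 (mulr_gt0 (ltr0n _ 4) k0)).
near=> alpha.
have LX : 2 * k - e <= L alpha.
  by near: alpha; apply: (cvgr_ge _ cL); rewrite ltrBlDr ltrDl.
have UX : U s alpha <= 2 * k + e.
  near: alpha; apply: (cvgr_le _ (cU s s1)).
  apply: (@le_lt_trans _ _ (2 * (1 + e / (4 * k)) * k)).
    by rewrite ler_pM2r// ler_pM2l.
  have -> : 2 * (1 + e / (4 * k)) * k = 2 * k + e / 2 by field; rewrite gt_eqF.
  by rewrite ltrD2l ltr_pdivrMr// ltr_pMr// ltr1n.
have /andP[lX Xu] : ((L alpha)%:E <= X alpha <= (U s alpha)%:E)%E.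
  by near: alpha; exact: XLU.
rewrite /= -/(X alpha); move: lX Xu; case: (X alpha) => [x||]//=.
rewrite !lee_fin => Lx xU.
by rewrite ler_distlC (le_trans LX Lx) (le_trans xU UX).
Unshelve. all: by end_near. Qed.
End CapacityLimit.

Unset Implicit Arguments.

Theorem mainTheorem6 (R : realType) (q : R) (hq : (1 <= q)%R) :
  (forall K : set R, compact K -> K !=set0 -> capW_compact K = 2%:E) /\
  (forall G : set R, open G -> G !=set0 -> capW_open G = 2%:E) /\
  (forall G : set R, open G -> G !=set0 -> bounded_set G ->
     (((1 - alpha) `^ (q^-1))%:E * capB_open alpha q G
        @[alpha --> (1%R : R)^'-] --> (q `^ (- q^-1))%:E * capW_open G) /\
     (q `^ (- q^-1))%:E * capW_open G = (2 * q `^ (- q^-1))%:E).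
Proof.
split; [|split].
- move=> K cK K0; apply/eqP; rewrite eq_le capW_compact_ge2// andbT.
  exact: capW_compact_le2.
- by move=> G oG G0; exact: capW_open_eq2.
- move=> G oG G0 bG.
  have -> : (q `^ (- q^-1))%:E * capW_open G = (2 * q `^ (- q^-1))%:E.
    by rewrite capW_open_eq2// muleC.
  by split => //; exact: capB_open_cvg.
Qed.
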